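(* Assume $\beta=\gamma$, and let $\delta>0$ be so small that $\alpha_1+\delta$ has the same sign as $\alpha_1$, $\beta-\delta>0$, $\gamma-\delta>0$, and $$\frac{L_f}{|\alpha_1|}\,\frac{e^{\alpha_1 h}-1}{e^{(\alpha_1+\delta)h}-1} + \frac{L_g}{\beta}\,\frac{1-e^{-\beta h}}{1-e^{-(\beta-\delta)h}} < 1 .$$ Let $x=\{x_i\}_{i\ge0}$ be the solution of $$x_i = b_i + \sum_{j=0}^{i-1} \frac{1}{\alpha_1}\omega_{ij}F_{ij}(x_j) + \sum_{j=i}^{\infty}\frac{1}{\beta}\varphi_{ij}G_{ij}(x_j), \quad i\ge 0,$$ and let $(x_{N,i})_{0\le i\le N}$ be the solution of the truncated system $$x_{N,i} = b_i + \sum_{j=0}^{i-1} \frac{1}{\alpha_1}\omega_{ij}F_{ij}(x_{N,j}) + \sum_{j=i}^{N}\frac{1}{\beta}\varphi_{ij}G_{ij}(x_{N,j}), \quad 0\le i\le N.$$ Then for every $\varepsilon>0$ and for every $i$ there is an $N(\varepsilon,i)$ such that $|x_{N,i}-x_i|<\varepsilon$ whenever $N\ge N(\varepsilon,i)$.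
   Context: Fix a norm $|\cdot|$ on $\mathbb{R}^n$ and a step size $h>0$. The real constants $\alpha_1,\alpha_2,\beta,\gamma$ satisfy $\alpha_1 \ne 0$, $\alpha_2 \ge 0$, $\alpha_1 \le \alpha_2$, $\beta > 0$, $\beta \ge \gamma$. The data are a function $x_0:[0,\infty)\to\mathbb{R}^n$ and $\mathbb{R}^n$-valued functions $f(t,s,x)$, defined for $0\le s\le t<\infty$, $x\in S$, and $g(t,s,x)$, defined for $0\le t\le s<\infty$, $x\in S$. Standing assumptions: (i) $f$ and $g$ are Lipschitz in $x\in S$ uniformly in $(t,s)$ in their respective domains, with Lipschitz constants $L_f$, $L_g$ satisfying $\frac{L_f}{|\alpha_1|} + \frac{L_g}{\beta} < 1$. (ii) $f$ and $g$ are continuous in all their arguments on their respective domains, and $|f|\le C_f$, $|g|\le C_g$ there, for constants $C_f,C_g$. (iii) $S = \{x\in\mathbb{R}^n : |x| \le \|x_0\|_\infty + \frac{C_f}{|\alpha_1|} + \frac{C_g}{\beta}\}$, where $\|x_0\|_\infty=\sup_{t\ge 0}|x_0(t)|$. (iv) $f$ and $g$ are continuously differentiable in $s$ and in $t$ on their respective domains, with bounded partial derivatives. (v) $x_0(\cdot)$ is bounded and differentiable with bounded derivative on $[0,\infty)$. Notation: $b_i = x_0(ih)$, $F_{ij}(\xi) = f(ih,jh,\xi)$ for $0\le j\le i-1$, $G_{ij}(\xi) = g(ih,jh,\xi)$ for $j\ge i$ (with $\xi\in S$), and $$\omega_{ij} = e^{(\alpha_1 j-\alpha_2 i)h}\,[e^{\alpha_1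 h}-1], \qquad \varphi_{ij} = e^{(-\beta j+\gamma i)h}\,[1-e^{-\beta h}].$$ The solution $x$ of the infinite-dimensional system is its unique solution with all $x_i\in S$; the solution of the truncated system is its unique solution with all $x_{N,i}\in S$. The quantity $x_{N,i}$ is defined for $0\le i\le N$ and extended by $x_{N,i}=0$ for $i\ge N+1$. Empty sums are zero. *)

(* Defs.v *)
From HB Require Import structures.
From mathcomp Require Import all_boot all_order all_algebra.
From mathcomp Require Import all_classical all_reals all_analysis.

Set Implicit Arguments.
Unset Strict Implicit.
Unset Printing Implicit Defensive.

Import Order.TTheory GRing.Theory Num.Theory.
Import numFieldNormedType.Exports.

Local Open Scope classical_set_scope.
Local Open Scope ring_scope.

(* An arbitrary norm on R^n. The canonical (sup) norm of 'rV[R]_n is used only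
   through the topology it induces, which is that of every norm on R^n. *)
Record is_norm (R : realType) (n : nat) (nrm : 'rV[R]_n -> R) : Prop := IsNorm {
  is_norm_triangle : forall x y, nrm (x + y) <= nrm x + nrm y;
  is_normZ : forall (a : R) x, nrm (a *: x) = `|a| * nrm x;
  is_norm_eq0 : forall x, nrm x = 0 -> x = 0 }.

Definition sup_norm (R : realType) (n : nat) (nrm : 'rV[R]_n -> R)
    (x0 : R -> 'rV[R]_n) : R :=
  sup [set nrm (x0 t) | t in [set t | 0 <= t]].

Definition state_set (R : realType) (n : nat) (nrm : 'rV[R]_n -> R)
    (x0 : R -> 'rV[R]_n) (alpha1 beta Cf Cg : R) : set 'rV[R]_n :=
  [set x | nrm x <= sup_norm nrm x0 + Cf / `|alpha1| + Cg / beta].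

(* Points (t, s, x) of the domains of f and g. The functions f and g are total
   in Rocq; only their values on these domains are ever used. *)
Definition dom_f (R : realType) (n : nat) (S : set 'rV[R]_n) :
    set (R * R * 'rV[R]_n) :=
  [set p | 0 <= p.1.2 <= p.1.1 /\ S p.2].

Definition dom_g (R : realType) (n : nat) (S : set 'rV[R]_n) :
    set (R * R * 'rV[R]_n) :=
  [set p | 0 <= p.1.1 <= p.1.2 /\ S p.2].

Definition lipschitz_in_state (R : realType) (n : nat) (nrm : 'rV[R]_n -> R)
    (D : set (R * R * 'rV[R]_n)) (f : R -> R -> 'rV[R]_n -> 'rV[R]_n)
    (L : R) : Prop :=
  0 <= L /\
  forall t s x y, D (t, s, x) -> D (t, s, y) ->
    nrm (f t s x - f t s y) <= L * nrm (x - y).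

Definition continuous_on (R : realType) (n : nat) (D : set (R * R * 'rV[R]_n))
    (f : R -> R -> 'rV[R]_n -> 'rV[R]_n) : Prop :=
  {within D, continuous (fun p : R * R * 'rV[R]_n => f p.1.1 p.1.2 p.2)}.

Definition bounded_on (R : realType) (n : nat) (nrm : 'rV[R]_n -> R)
    (D : set (R * R * 'rV[R]_n)) (f : R -> R -> 'rV[R]_n -> 'rV[R]_n)
    (C : R) : Prop :=
  forall t s x, D (t, s, x) -> nrm (f t s x) <= C.

(* l is the derivative at t of u restricted to A; it is one-sided at an
   endpoint of an interval A, and unconstrained at an isolated point of A. *)
Definition has_derivative_within (R : realType) (n : nat) (A : set R)
    (u : R -> 'rV[R]_n) (t : R) (l : 'rV[R]_n) : Prop :=
  (y - t)^-1 *: (u y - u t) @[y --> within A t^'] --> l.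

(* For the domains above, the slice through a point is a single point only at
   t = s = 0; there the continuity of f' determines its value. *)
Definition C1_bounded_in_t (R : realType) (n : nat) (nrm : 'rV[R]_n -> R)
    (D : set (R * R * 'rV[R]_n))
    (f : R -> R -> 'rV[R]_n -> 'rV[R]_n) : Prop :=
  exists f' : R -> R -> 'rV[R]_n -> 'rV[R]_n,
    [/\ forall t s x, D (t, s, x) ->
          has_derivative_within [set r | D (r, s, x)]
            (fun r => f r s x) t (f' t s x),
        continuous_on D f' &
        exists M, bounded_on nrm D f' M].

Definition C1_bounded_in_s (R : realType) (n : nat) (nrm : 'rV[R]_n -> R)
    (D : set (R * R * 'rV[R]_n))
    (f : R -> R -> 'rV[R]_n -> 'rV[R]_n) : Prop :=
  exists f' : R -> R -> 'rV[R]_n -> 'rV[R]_n,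
    [/\ forall t s x, D (t, s, x) ->
          has_derivative_within [set r | D (t, r, x)]
            (fun r => f t r x) s (f' t s x),
        continuous_on D f' &
        exists M, bounded_on nrm D f' M].

Definition bounded_half_line (R : realType) (n : nat) (nrm : 'rV[R]_n -> R)
    (u : R -> 'rV[R]_n) : Prop :=
  exists M, forall t, 0 <= t -> nrm (u t) <= M.

Definition differentiable_bounded_half_line (R : realType) (n : nat)
    (nrm : 'rV[R]_n -> R) (u : R -> 'rV[R]_n) : Prop :=
  exists2 u' : R -> 'rV[R]_n,
    forall t, 0 <= t -> has_derivative_within [set r | 0 <= r] u t (u' t) &
    bounded_half_line nrm u'.

Definition omega (R : realType) (alpha1 alpha2 h : R) (i j : nat) : R :=
  expR ((alpha1 * j%:R - alpha2 * i%:R) * h) * (expR (alpha1 * h) - 1).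

Definition phi (R : realType) (beta gamma h : R) (i j : nat) : R :=
  expR ((- beta * j%:R + gamma * i%:R) * h) * (1 - expR (- beta * h)).

(* x0(ih), and f(ih, jh, xi) for either kernel. *)
Definition sample0 (R : realType) (n : nat) (x0 : R -> 'rV[R]_n) (h : R)
    (i : nat) : 'rV[R]_n := x0 (i%:R * h).

Definition sample (R : realType) (n : nat)
    (f : R -> R -> 'rV[R]_n -> 'rV[R]_n) (h : R) (i j : nat)
    (xi : 'rV[R]_n) : 'rV[R]_n := f (i%:R * h) (j%:R * h) xi.

Definition solves_infinite_system (R : realType) (n : nat)
    (alpha1 alpha2 beta gamma h : R) (x0 : R -> 'rV[R]_n)
    (f g : R -> R -> 'rV[R]_n -> 'rV[R]_n) (S : set 'rV[R]_n)
    (x : nat -> 'rV[R]_n) : Prop :=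
  forall i : nat,
    [/\ S (x i),
        cvgn (fun m : nat => \sum_(i <= j < m)
          (beta^-1 * phi beta gamma h i j) *: sample g h i j (x j)) &
        x i = sample0 x0 h i
          + \sum_(0 <= j < i)
              (alpha1^-1 * omega alpha1 alpha2 h i j) *: sample f h i j (x j)
          + limn (fun m : nat => \sum_(i <= j < m)
              (beta^-1 * phi beta gamma h i j) *: sample g h i j (x j))].

Definition solves_truncated_system (R : realType) (n : nat)
    (alpha1 alpha2 beta gamma h : R) (x0 : R -> 'rV[R]_n)
    (f g : R -> R -> 'rV[R]_n -> 'rV[R]_n) (S : set 'rV[R]_n) (N : nat)
    (y : nat -> 'rV[R]_n) : Prop :=
  forall i : nat, (i <= N)%N ->
    S (y i) /\
    y i = sample0 x0 h i
      + \sum_(0 <= j < i)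
          (alpha1^-1 * omega alpha1 alpha2 h i j) *: sample f h i j (y j)
      + \sum_(i <= j < N.+1)
          (beta^-1 * phi beta gamma h i j) *: sample g h i j (y j).

(* Main.v *)
Require Import Defs.
From HB Require Import structures.
From mathcomp Require Import all_boot all_order all_algebra.
From mathcomp Require Import all_classical all_reals all_analysis.
From mathcomp Require Import ring lra.

Import Order.TTheory GRing.Theory Num.Theory.
Import numFieldNormedType.Exports.

Local Open Scope classical_set_scope.
Local Open Scope ring_scope.

(** On the indices i <= N put e_i = |x_{N,i} - x_i|.  Subtracting the two systems
    and using the Lipschitz bounds gives (truncation_error_le)
      e_i <= sum_(j < i) a_ij e_j + sum_(i <= j <= N) b_ij e_j + tail_i,
    with a_ij = (L_f / |alpha1|) |omega_ij|, b_ij = (L_g / beta) phi_ij, and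
    tail_i the part of the infinite sum beyond N.  The bound
    (C_g / beta) e^{-beta (N + 1 - i) h} on this tail is not small for i near N.  So the errors are compared with the growing weight
    w_i = e^{delta h i}, against which the tail is uniformly small: it is at most
    (C_g / beta) e^{-delta h (N + 1)} w_i, because delta < beta (sum_phi_tail).

    The kernels still contract in the weighted sup norm.  Multiplying omega_ij or
    phi_ij by w_j only replaces alpha1 by alpha1 + delta, respectively beta by
    beta - delta, up to the quotient in the smallness condition on delta
    (omega_expR, phi_expR); the new kernels are again differences of consecutive
    exponentials in j, so their sums telescope, to at most w_i
    (sum_norm_omega_expR, sum_phi_expR).  Hence the weighted row sums are at most
    rho w_i, where rho < 1 is the left-hand side of that condition, and the
    maximum of e_i / w_i is at most (C_g / beta) e^{-delta h (N + 1)} / (1 - rho)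
    (weighted_error_bound).  For fixed i this tends to 0 as N grows. *)

(** * Arbitrary norms on row vectors *)

Section ArbitraryNorm.
Context {R : realType} {n : nat} {nrm : 'rV[R]_n -> R} (nrm_norm : is_norm nrm).

Lemma nrm0 : nrm 0 = 0.
Proof. by rewrite -(scale0r 0) (is_normZ nrm_norm) normr0 mul0r. Qed.

Lemma nrmN x : nrm (- x) = nrm x.
Proof. by rewrite -scaleN1r (is_normZ nrm_norm) normrN1 mul1r. Qed.

Lemma nrm_ge0 x : 0 <= nrm x.
Proof.
have := is_norm_triangle nrm_norm x (- x).
rewrite subrr nrm0 nrmN; lra.
Qed.

Lemma nrm_sum (I : Type) (r : seq I) (P : pred I) (F : I -> 'rV[R]_n) :
  nrm (\sum_(i <- r | P i) F i) <= \sum_(i <- r | P i) nrm (F i).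
Proof.
elim/big_ind2 : _ => //; first by rewrite nrm0.
move=> u a v b ua vb.
exact: le_trans (is_norm_triangle nrm_norm _ _) (lerD ua vb).
Qed.

(** Convergence in 'rV[R]_n refers to the sup norm; this domination, obtained by
    expanding x in the canonical basis, transfers it to nrm. *)
Lemma nrm_le_mx_norm : exists2 K : R, 0 <= K & forall x, nrm x <= K * `|x|.
Proof.
exists (\sum_(j < n) nrm 'e_j); first by apply: sumr_ge0 => j _; exact: nrm_ge0.
move=> x; rewrite {1}[x]row_sum_delta mulr_suml.
apply: le_trans (nrm_sum _ _ _ _) _; apply: ler_sum => j _.
rewrite (is_normZ nrm_norm) mulrC ler_wpM2l ?nrm_ge0//.
rewrite [`|x|]mx_normrE.
exact: (le_bigmax_cond 0 (fun ij : 'I_1 * 'I_n => `|x ij.1 ij.2|) (isT : xpredT (0, j))).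
Qed.

(** Closed balls of nrm are closed: used to bound the remainder of the infinite
    sum by a bound on its partial sums. *)
Lemma nrm_lim_le (u : nat -> 'rV[R]_n) (v : 'rV[R]_n) (c : R) (M : nat) :
    cvgn u -> (forall m, (M <= m)%N -> nrm (u m - v) <= c) ->
  nrm (limn u - v) <= c.
Proof.
move=> cvu ule; have [K K0 nrmK] := nrm_le_mx_norm.
apply/ler_addgt0Pr => e e0.
have K10 : 0 < K + 1 by lra.
have /cvgrPdist_le/(_ (e / (K + 1)) (divr_gt0 e0 K10)) [M' _ ltM'] := cvu.
have {}ltM' := ltM' (maxn M M') (leq_maxr _ _).
have {}ule := ule (maxn M M') (leq_maxl _ _).
rewrite -(subrK (u (maxn M M')) (limn u)) -addrA addrC.
apply: le_trans (is_norm_triangle nrm_norm _ _) (lerD ule _).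
apply: le_trans (nrmK _) _.
apply: le_trans (ler_wpM2l K0 ltM') _.
by rewrite mulrCA ler_piMr ?(ltW e0)// ler_pdivrMr//; lra.
Qed.

End ArbitraryNorm.

(** * A discrete Gronwall inequality *)

(** Evaluate the inequality for e at an index k where D = e k / w k is maximal:
    replacing every e j by D * w j there turns it into D <= rho * D + tau.
    The sum is split at i so that a can carry the Volterra part of the system
    and b its Fredholm part. *)
Lemma weighted_error_bound (R : realFieldType) (N : nat) (a b : nat -> nat -> R)
    (w e : nat -> R) (rho tau : R) :
    (forall i j, 0 <= a i j) -> (forall i j, 0 <= b i j) ->
    (forall i, 0 < w i) -> (forall i, 0 <= e i) -> rho < 1 ->
    (forall i, (i <= N)%N ->
      \sum_(0 <= j < i) a i j * w j + \sum_(i <= j < N.+1) b i j * w j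
        <= rho * w i) ->
    (forall i, (i <= N)%N ->
      e i <= \sum_(0 <= j < i) a i j * e j + \sum_(i <= j < N.+1) b i j * e j
        + tau * w i) ->
  forall i, (i <= N)%N -> e i <= tau / (1 - rho) * w i.
Proof.
move=> a0 b0 w0 e0 rho1 kw ke.
have [k _ kmax] := @arg_maxP _ R 'I_N.+1 ord0 xpredT (fun i => e i / w i) isT.
set D := e k / w k in kmax.
have D0 : 0 <= D by rewrite divr_ge0// ltW.
have eD i : (i <= N)%N -> e i <= D * w i.
  by move=> iN; rewrite -ler_pdivrMr//; exact: (kmax (Ordinal (iN : i < N.+1)%N)).
have kN : (k <= N)%N by rewrite -ltnS.
have D_le : D <= tau / (1 - rho).
  rewrite ler_pdivlMr ?subr_gt0//.
  have : D * w k <= rho * D * w k + tau * w k.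
    rewrite {1}/D divfK ?gt_eqF//.
    apply: le_trans (ke _ kN) _; rewrite lerD2r.
    have D0w : \sum_(0 <= j < k) a k j * e j + \sum_(k <= j < N.+1) b k j * e j
        <= D * (\sum_(0 <= j < k) a k j * w j + \sum_(k <= j < N.+1) b k j * w j).
      rewrite mulrDr !mulr_sumr; apply: lerD; apply: ler_sum_nat => j /andP[kj jk];
        rewrite mulrCA; apply: ler_wpM2l => //; apply: eD.
        by rewrite (leq_trans (ltnW jk)).
      by rewrite -ltnS.
    apply: le_trans D0w _.
    by rewrite [leRHS]mulrAC [leRHS]mulrC ler_wpM2l// kw.
  by rewrite -mulrDl ler_pM2r//; lra.
move=> i iN; apply: le_trans (eD _ iN) _; by rewrite ler_pM2r.
Qed.

(** * Weighted sums of the kernels *)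

Section Kernels.
Context {R : realType}.
Implicit Types (a alpha beta gamma delta h : R) (i j m N : nat).

Lemma omegaE a alpha h i j : omega a alpha h i j =
  expR ((a * j.+1%:R - alpha * i%:R) * h) - expR ((a * j%:R - alpha * i%:R) * h).
Proof.
rewrite /omega mulrBr mulr1 -expRD; congr (expR _ - _).
by rewrite -natr1; ring.
Qed.

Lemma phiE beta gamma h i j : phi beta gamma h i j =
  expR ((gamma * i%:R - beta * j%:R) * h)
    - expR ((gamma * i%:R - beta * j.+1%:R) * h).
Proof.
rewrite /phi mulrBr mulr1 -expRD; congr (expR _ - expR _); first by ring.
by rewrite -natr1; ring.
Qed.

Lemma sum_omega a alpha h i : \sum_(0 <= j < i) omega a alpha h i j =
  expR ((a - alpha) * i%:R * h) - expR (- alpha * i%:R * h).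
Proof.
under eq_bigr do rewrite omegaE.
rewrite (telescope_sumr (fun j => expR ((a * j%:R - alpha * i%:R) * h)))//.
by congr (expR _ - expR _); ring.
Qed.

Lemma sum_phi beta gamma h i j m : (j <= m)%N ->
  \sum_(j <= k < m) phi beta gamma h i k =
  expR ((gamma * i%:R - beta * j%:R) * h) - expR ((gamma * i%:R - beta * m%:R) * h).
Proof.
move=> jm; under eq_bigr do rewrite phiE -opprB.
rewrite sumrN (telescope_sumr (fun k => expR ((gamma * i%:R - beta * k%:R) * h)))//.
by rewrite opprB.
Qed.

Lemma sgr_expR_subr1 (c : R) : Num.sg (expR c - 1) = Num.sg c.
Proof.
case: (ltrgt0P c) => [c0|c0|->]; last by rewrite expR0 subrr.
- by rewrite (gtr0_sg c0) gtr0_sg// subr_gt0 expR_gt1.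
- by rewrite (ltr0_sg c0) ltr0_sg// subr_lt0 expR_lt1.
Qed.

Lemma sgr_omega a alpha h i j : 0 < h -> Num.sg (omega a alpha h i j) = Num.sg a.
Proof.
move=> h0; rewrite /omega sgrM gtr0_sg ?expR_gt0// mul1r sgr_expR_subr1.
by rewrite sgrM (gtr0_sg h0) mulr1.
Qed.

Lemma phi_ge0 beta gamma h i j : 0 <= beta -> 0 <= h -> 0 <= phi beta gamma h i j.
Proof.
move=> b0 h0; rewrite mulr_ge0 ?expR_ge0// subr_ge0 -expR0 ler_expR.
by rewrite mulNr oppr_le0 mulr_ge0.
Qed.

(** The weight shifts the exponent, and the factor e^{a h} - 1 of omega, which
    depends on that exponent, accounts for the quotient. *)
Lemma omega_expR a alpha delta h i j : 0 < h -> a + delta != 0 ->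
  omega a alpha h i j * expR (delta * h * j%:R) =
  (expR (a * h) - 1) / (expR ((a + delta) * h) - 1) * omega (a + delta) alpha h i j.
Proof.
move=> h0 ad0; have q0 : expR ((a + delta) * h) - 1 != 0.
  by rewrite -sgr_eq0 sgr_expR_subr1 sgr_eq0 mulf_neq0 ?(gt_eqF h0).
rewrite /omega [RHS]mulrCA divfK// mulrAC -expRD; congr (expR _ * _); ring.
Qed.

Lemma phi_expR beta gamma delta h i j : 0 < h -> 0 < beta - delta ->
  phi beta gamma h i j * expR (delta * h * j%:R) =
  (1 - expR (- beta * h)) / (1 - expR (- (beta - delta) * h))
    * phi (beta - delta) gamma h i j.
Proof.
move=> h0 bd0; have q0 : 1 - expR (- (beta - delta) * h) != 0.
  rewrite -opprB oppr_eq0 -sgr_eq0 sgr_expR_subr1 sgr_eq0.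
  by rewrite mulf_neq0 ?oppr_eq0 ?(gt_eqF h0) ?(gt_eqF bd0).
rewrite /phi [RHS]mulrCA divfK// mulrAC -expRD; congr (expR _ * _); ring.
Qed.

(** All omega a alpha h i j have the sign of a, so the sum of the absolute
    values is the absolute value of the telescoped sum, a difference of two
    positive terms both at most e^{delta h i}. *)
Lemma sum_norm_omega a alpha delta h i : 0 < h -> 0 <= alpha -> 0 <= delta ->
    a <= alpha + delta ->
  \sum_(0 <= j < i) `|omega a alpha h i j| <= expR (delta * h * i%:R).
Proof.
move=> h0 al0 de0 ale.
under eq_bigr do rewrite normrEsg sgr_omega//.
rewrite -mulr_sumr sum_omega.
have i0 : 0 <= i%:R :> R by [].
have p1 : expR ((a - alpha) * i%:R * h) <= expR (delta * h * i%:R).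
  by rewrite ler_expR mulrAC !ler_wpM2r// ?(ltW h0)//; lra.
have p2 : expR (- alpha * i%:R * h) <= expR (delta * h * i%:R).
  by rewrite ler_expR mulrAC !ler_wpM2r// ?(ltW h0)//; lra.
have := expR_gt0 ((a - alpha) * i%:R * h); have := expR_gt0 (- alpha * i%:R * h).
have := expR_gt0 (delta * h * i%:R).
by case: sgrP => _; lra.
Qed.

(** The sign condition on a + delta makes the quotient positive for both signs
    of a. *)
Lemma sum_norm_omega_expR a alpha delta h i : 0 < h -> 0 <= alpha -> a <= alpha ->
    0 <= delta -> a != 0 -> Num.sg (a + delta) = Num.sg a ->
  \sum_(0 <= j < i) `|omega a alpha h i j| * expR (delta * h * j%:R) <=
  (expR (a * h) - 1) / (expR ((a + delta) * h) - 1) * expR (delta * h * i%:R).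
Proof.
move=> h0 al0 ale de0 a0 sga.
have ad0 : a + delta != 0 by rewrite -sgr_eq0 sga sgr_eq0.
have q0 : 0 <= (expR (a * h) - 1) / (expR ((a + delta) * h) - 1).
  rewrite -sgr_ge0 sgrM sgrV !sgr_expR_subr1 !sgrM sga (gtr0_sg h0) mulr1.
  by rewrite -expr2 sqr_ge0.
under eq_bigr => j _.
  rewrite -[expR (delta * h * j%:R)]ger0_norm ?expR_ge0// -normrM omega_expR//.
  rewrite normrM (ger0_norm q0); over.
by rewrite -mulr_sumr ler_wpM2l// sum_norm_omega// lerD2r.
Qed.

(** The sum of phi (beta - delta) beta h i from i on telescopes to at most
    e^{(beta - (beta - delta)) h i}, which is the weight at i. *)
Lemma sum_phi_expR beta delta h i m : 0 < h -> 0 <= delta -> 0 < beta - delta ->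
    (i <= m)%N ->
  \sum_(i <= j < m) phi beta beta h i j * expR (delta * h * j%:R) <=
  (1 - expR (- beta * h)) / (1 - expR (- (beta - delta) * h))
    * expR (delta * h * i%:R).
Proof.
move=> h0 de0 bd0 im.
under eq_bigr do rewrite phi_expR//.
rewrite -mulr_sumr sum_phi// ler_wpM2l//.
  by rewrite divr_ge0// subr_ge0 -expR0 ler_expR mulNr oppr_le0 mulr_ge0//; lra.
have -> : (beta * i%:R - (beta - delta) * i%:R) * h = delta * h * i%:R by ring.
by rewrite lerBlDr lerDl expR_ge0.
Qed.

(** The tail is at most e^{-beta (N - i) h}; as i <= N, part of this decay,
    e^{-(beta - delta) (N - i) h} <= 1, can be given up so that the rest is a
    factor depending on N times the weight at i. *)
Lemma sum_phi_tail beta delta h i N m : 0 < h -> 0 <= delta -> delta <= beta ->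
    (i <= N)%N -> (N <= m)%N ->
  \sum_(N <= j < m) phi beta beta h i j <=
  expR (- (delta * h) * N%:R) * expR (delta * h * i%:R).
Proof.
move=> h0 de0 deb iN Nm; rewrite sum_phi// -expRD.
apply: (@le_trans _ _ (expR ((beta * i%:R - beta * N%:R) * h))).
  by rewrite lerBlDr lerDl expR_ge0.
rewrite ler_expR -subr_ge0.
have -> : - (delta * h) * N%:R + delta * h * i%:R - (beta * i%:R - beta * N%:R) * h
  = (beta - delta) * h * (N%:R - i%:R) by ring.
by rewrite !mulr_ge0 ?subr_ge0 ?ler_nat// ltW.
Qed.

End Kernels.

(** * Comparison of the two systems *)

(** The two systems share all terms with index at most N except for their
    arguments, which the Lipschitz bounds compare; the terms of the infinite
    system beyond N are estimated by the bound Cg alone. *)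
Lemma truncation_error_le {R : realType} {n : nat} {nrm : 'rV[R]_n -> R}
    {h alpha1 alpha2 beta gamma Lf Lg Cg : R} {x0 : R -> 'rV[R]_n}
    {f g : R -> R -> 'rV[R]_n -> 'rV[R]_n} {X : set 'rV[R]_n}
    {x y : nat -> 'rV[R]_n} {N : nat} (i : nat) (T : R) :
    is_norm nrm -> 0 < h -> 0 < beta ->
    lipschitz_in_state nrm (dom_f X) f Lf ->
    lipschitz_in_state nrm (dom_g X) g Lg ->
    bounded_on nrm (dom_g X) g Cg ->
    solves_infinite_system alpha1 alpha2 beta gamma h x0 f g X x ->
    solves_truncated_system alpha1 alpha2 beta gamma h x0 f g X N y ->
    (i <= N)%N ->
    (forall m, (N < m)%N -> \sum_(N.+1 <= j < m) phi beta gamma h i j <= T) ->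
  nrm (y i - x i) <=
    \sum_(0 <= j < i)
      Lf / `|alpha1| * `|omega alpha1 alpha2 h i j| * nrm (y j - x j)
    + \sum_(i <= j < N.+1) Lg / beta * phi beta gamma h i j * nrm (y j - x j)
    + Cg / beta * T.
Proof.
move=> nrmP h0 b0 [Lf0 flip] [Lg0 glip] gC xsol ysol iN tailT.
have Xx j : X (x j) by have [] := xsol j.
have Xy j : (j <= N)%N -> X (y j) by move=> /ysol[].
have domf j (z : 'rV[R]_n) : (j <= i)%N -> X z -> dom_f X (i%:R * h, j%:R * h, z).
  by move=> ji Xz; split => //=; rewrite mulr_ge0 ?ler_pM2r ?ler_nat// ltW.
have domg j (z : 'rV[R]_n) : (i <= j)%N -> X z -> dom_g X (i%:R * h, j%:R * h, z).
  by move=> ij Xz; split => //=; rewrite mulr_ge0 ?ler_pM2r ?ler_nat// ltW.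
have phi0 j : 0 <= beta^-1 * phi beta gamma h i j.
  by rewrite mulr_ge0 ?invr_ge0 ?phi_ge0 ?ltW.
have Cg0 : 0 <= Cg := le_trans (nrm_ge0 nrmP _) (gC _ _ _ (domg _ _ (leqnn i) (Xx i))).
have [_ cvu ->] := xsol i.
set u := fun m : nat => _ in cvu *.
have [_ ->] := ysol i iN.
set b := sample0 x0 h i.
set F := (X in b + X + _ - _); set G := (X in b + F + X - _).
set F' := (X in _ - (b + X + _)).
have -> : b + F + G - (b + F' + limn u) = (F - F') + (G - u N.+1) - (limn u - u N.+1).
  by rewrite opprB opprD !addrA; apply/rowP => k; rewrite !mxE; ring.
apply: le_trans (is_norm_triangle nrmP _ _) _; apply: lerD; last first.
  (* The remainder of the infinite sum beyond N. *)
  rewrite nrmN//; apply: (nrm_lim_le nrmP u (u N.+1) _ N.+1) => // m Nm.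
  rewrite /u (big_cat_nat (n := N.+1)) ?(leqW iN)//= [X in nrm (X - _)]addrC addrK.
  apply: le_trans (nrm_sum nrmP _ _ _ _) _.
  apply: le_trans (_ : \sum_(N.+1 <= j < m) Cg / beta * phi beta gamma h i j <= _).
    apply: ler_sum_nat => j /andP[Nj _].
    rewrite (is_normZ nrmP) ger0_norm// mulrC -mulrA ler_wpM2r//.
    by apply: gC; apply: domg => //; rewrite (leq_trans iN)// ltnW.
  by rewrite -mulr_sumr ler_wpM2l ?tailT// divr_ge0// ltW.
apply: le_trans (is_norm_triangle nrmP _ _) _; apply: lerD.
- rewrite /F /F' -sumrB; apply: le_trans (nrm_sum nrmP _ _ _ _) _.
  apply: ler_sum_nat => j /andP[_ ji].
  rewrite -scalerBr (is_normZ nrmP) normrM normfV.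
  have -> : Lf / `|alpha1| * `|omega alpha1 alpha2 h i j| * nrm (y j - x j) =
      `|alpha1|^-1 * `|omega alpha1 alpha2 h i j| * (Lf * nrm (y j - x j)) by ring.
  rewrite ler_wpM2l ?mulr_ge0 ?invr_ge0//.
  by apply: flip; apply: domf; rewrite ?(ltnW ji)//; apply/Xy/(leq_trans (ltnW ji)).
- rewrite /G /u -sumrB; apply: le_trans (nrm_sum nrmP _ _ _ _) _.
  apply: ler_sum_nat => j /andP[ij jN].
  rewrite -scalerBr (is_normZ nrmP) ger0_norm//.
  have -> : Lg / beta * phi beta gamma h i j * nrm (y j - x j) =
      beta^-1 * phi beta gamma h i j * (Lg * nrm (y j - x j)) by ring.
  by rewrite ler_wpM2l//; apply: glip; apply: domg => //; exact: Xy.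
Qed.

Theorem corollary3p1 (R : realType) (n : nat) (nrm : 'rV[R]_n -> R)
    (h alpha1 alpha2 beta gamma Lf Lg Cf Cg delta : R)
    (x0 : R -> 'rV[R]_n) (f g : R -> R -> 'rV[R]_n -> 'rV[R]_n)
    (X : set 'rV[R]_n)
    (x : nat -> 'rV[R]_n) (xN : nat -> nat -> 'rV[R]_n)
    (nrm_norm : is_norm nrm)
    (h_gt0 : 0 < h)
    (alpha1_neq0 : alpha1 != 0) (alpha2_ge0 : 0 <= alpha2)
    (alpha1_le : alpha1 <= alpha2)
    (beta_gt0 : 0 < beta) (gamma_le : gamma <= beta)
    (f_lip : lipschitz_in_state nrm (dom_f X) f Lf)
    (g_lip : lipschitz_in_state nrm (dom_g X) g Lg)
    (contraction : Lf / `|alpha1| + Lg / beta < 1)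
    (f_cont : continuous_on (dom_f X) f)
    (g_cont : continuous_on (dom_g X) g)
    (f_bnd : bounded_on nrm (dom_f X) f Cf)
    (g_bnd : bounded_on nrm (dom_g X) g Cg)
    (X_def : X = state_set nrm x0 alpha1 beta Cf Cg)
    (f_C1s : C1_bounded_in_s nrm (dom_f X) f)
    (f_C1t : C1_bounded_in_t nrm (dom_f X) f)
    (g_C1s : C1_bounded_in_s nrm (dom_g X) g)
    (g_C1t : C1_bounded_in_t nrm (dom_g X) g)
    (x0_bnd : bounded_half_line nrm x0)
    (x0_diff : differentiable_bounded_half_line nrm x0)
    (beta_eq_gamma : beta = gamma)
    (delta_gt0 : 0 < delta)
    (delta_sg : Num.sg (alpha1 + delta) = Num.sg alpha1)
    (beta_delta : 0 < beta - delta) (gamma_delta : 0 < gamma - delta)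
    (delta_small :
      Lf / `|alpha1|
        * ((expR (alpha1 * h) - 1) / (expR ((alpha1 + delta) * h) - 1))
      + Lg / beta
        * ((1 - expR (- beta * h)) / (1 - expR (- (beta - delta) * h))) < 1)
    (x_sol : solves_infinite_system alpha1 alpha2 beta gamma h x0 f g X x)
    (xN_sol : forall N : nat,
      solves_truncated_system alpha1 alpha2 beta gamma h x0 f g X N (xN N))
    (xN_ext : forall N i : nat, (N < i)%N -> xN N i = 0) :
  forall eps : R, 0 < eps -> forall i : nat,
    exists N0 : nat, forall N : nat, (N0 <= N)%N ->
      nrm (xN N i - x i) < eps.
Proof.
move=> eps eps0 i.
have [Lf0 _] := f_lip; have [Lg0 _] := g_lip.
subst gamma.
set rho := (X in X < 1) in delta_small.
set q : R := expR (- (delta * h)).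
set K : R := Cg / beta / (1 - rho) * expR (delta * h * i%:R).
have dh0 : 0 < delta * h by rewrite mulr_gt0.
have err N : (i <= N)%N -> nrm (xN N i - x i) <= K * q ^+ N.+1.
  move=> iN.
  have -> : K * q ^+ N.+1 =
      (Cg / beta * q ^+ N.+1) / (1 - rho) * expR (delta * h * i%:R).
    by rewrite /K; ring.
  apply: (@weighted_error_bound _ N
    (fun k j => Lf / `|alpha1| * `|omega alpha1 alpha2 h k j|)
    (fun k j => Lg / beta * phi beta beta h k j)
    (fun j => expR (delta * h * j%:R)) (fun j => nrm (xN N j - x j))
    rho) => //.
  - by move=> k j; rewrite mulr_ge0// divr_ge0.
  - by move=> k j; rewrite mulr_ge0 ?phi_ge0 ?divr_ge0 ?(ltW beta_gt0) ?(ltW h_gt0).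
  - by move=> k; rewrite expR_gt0.
  - by move=> k; exact: nrm_ge0.
  - move=> k kN /=; rewrite /rho mulrDl; apply: lerD.
      under eq_bigr do rewrite -[_ * expR _]mulrA.
      rewrite -mulr_sumr -[leRHS]mulrA ler_wpM2l ?divr_ge0//.
      by apply: sum_norm_omega_expR => //; exact: ltW.
    under eq_bigr do rewrite -[_ * expR _]mulrA.
    rewrite -mulr_sumr -[leRHS]mulrA ler_wpM2l ?divr_ge0 ?(ltW beta_gt0)//.
    by apply: sum_phi_expR; rewrite ?(ltW delta_gt0) ?(leqW kN).
  - move=> k kN; rewrite -[_ * q ^+ _ * _]mulrA.
    apply: (truncation_error_le _ _ nrm_norm h_gt0 beta_gt0 f_lip g_lip g_bnd x_sol
      (xN_sol N) kN) => m Nm.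
    rewrite /q -expRM_natr.
    by apply: sum_phi_tail => //; rewrite ?(ltW delta_gt0) ?(leqW kN)// -subr_ge0 ltW.
have q1 : `|q| < 1 by rewrite ger0_norm ?expR_ge0// expR_lt1 oppr_lt0.
have /cvgrPdist_lt/(_ eps eps0) [N0 _ N0P] : K * q ^+ N @[N --> \oo] --> K * 0.
  exact: cvgMl_tmp (cvg_expr q1).
exists (maxn N0 i) => N; rewrite geq_max => /andP[N0N iN].
apply: le_lt_trans (err N iN) _.
apply: le_lt_trans (ler_norm _) _.
by have := N0P N.+1 (leqW N0N); rewrite mulr0 sub0r normrN.
Qed.
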